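(* Let $(A,\cdot,D,Q)$ be an admissible commutative differential algebra, $q\in\mathbf{k}$, $(A,\circ_q)$ the induced Novikov algebra, $a\circ_q b=a\cdot(D+qQ)(b)$, and $T:V\to A$ an $\mathcal{O}$-operator on $(A,\cdot,D,Q)$ associated to a representation $(V,l_A,\alpha,\beta)$. If $q=-\frac12$ or $$l_A(a)(\alpha+\beta)(v)=0,\qquad a\in A,\ v\in V, \qquad(\ast)$$ then $$l_{l_A,q}^*+r_{l_A,q}^*=l_{-l_A^*,q},\qquad -r_{l_A,q}^*=r_{-l_A^*,q}.$$ Furthermore, suppose that $q=-\frac12$, or that $(\ast)$ holds together with the extra condition $$a\cdot(D+Q)(b)=0,\quad l_A((D+Q)(a))v=0,\quad(\alpha+\beta)(l_A(a)v)=0,\qquad a,b\in A,\ v\in V.$$ Then the following two approaches that start with $T$ to obtain $r=r_T-\tau r_T$ as an antisymmetric solution of the Novikov Yang-Baxter equation (NYBE) coincide (that is, both apply and yield the same $r$ as a solution in the same Novikov algebra $A\ltimes_{l_{l_A,q}^*+r_{l_A,q}^*,\,-r_{l_A,q}^*}V^*=A\ltimes_{l_{-l_A^*,q},\,r_{-l_A^*,q}}V^*$): (i) $T$ is an $\mathcal{O}$-operator on $(A,\circ_q)$ associated to $(V,l_{l_A,q},r_{l_A,q})$, whence $r$ is an antisymmetric solution of the NYBE in $A\ltimes_{l_{l_A,q}^*+r_{l_A,q}^*,\,-r_{l_A,q}^*}V^*$; (ii) $r$ is an antisymmetric solution of the admissible associative Yang-Baxter equation in $(A\ltimes_{-l_A^*}V^*,\cdot,D+\beta^*,Q+\alpha^*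 )$, whence $r$ is an antisymmetric solution of the NYBE in the Novikov algebra $A\ltimes_{l_{-l_A^*,q},\,r_{-l_A^*,q}}V^*$ induced from it.
   Context: $\mathbf{k}$ is a field of characteristic $0$; all vector spaces are over $\mathbf{k}$ and finite-dimensional. $\tau(x\otimes y)=y\otimes x$. Duals: for a linear map $\varphi:V\to W$ between vector spaces, $\varphi^*:W^*\to V^*$ is the transpose $\langle\varphi^*(f),v\rangle=\langle f,\varphi(v)\rangle$ (used for $\alpha^*,\beta^*$). For a linear map $\varphi:A\to\mathrm{End}_{\mathbf{k}}(V)$, $\varphi^*:A\to\mathrm{End}_{\mathbf{k}}(V^* )$ is defined with a sign: $\langle\varphi^*(a)f,v\rangle=-\langle f,\varphi(a)v\rangle$ (used for $l_A^*,l_{l_A,q}^*,r_{l_A,q}^*$). Admissible commutative differential algebra $(A,\cdot,D,Q)$: $(A,\cdot)$ commutative associative, $D,Q$ linear, $D(a\cdot b)=D(a)\cdot b+a\cdot D(b)$, $Q(a\cdot b)=Q(a)\cdot b-a\cdot D(b)$; then $a\circ_q b=a\cdot(D+qQ)(b)$ is a Novikov product ($(a\circ b)\circ c-a\circ(b\circ c)=(b\circ a)\circ c-b\circ(a\circ c)$, $(a\circ b)\circ c=(a\circ c)\circ b$). Representation $(V,l_A,\alpha,\beta)$ of $(A,\cdot,D,Q)$: $l_A:A\to\mathrm{End}_{\mathbf{k}}(V)$ linear with $l_A(a\cdot b)=l_A(a)l_A(b)$, and $\alpha,\beta:V\to V$ linear with $\alpha(l_A(a)v)=l_A(D(a))v+l_A(a)\alpha(v)$,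 $\beta(l_A(a)v)=l_A(a)\beta(v)-l_A(D(a))v=l_A(Q(a))v-l_A(a)\alpha(v)$. For such a representation put $l_{l_A,q}(a)v=l_A(a)(\alpha+q\beta)(v)$, $r_{l_A,q}(a)v=l_A((D+qQ)(a))v$; $(V,l_{l_A,q},r_{l_A,q})$ is a representation of $(A,\circ_q)$. Also $(V^*,-l_A^*,\beta^*,\alpha^* )$ is a representation of $(A,\cdot,D,Q)$, and correspondingly $l_{-l_A^*,q}(a)f=-l_A^*(a)(\beta^*+q\alpha^* )(f)$, $r_{-l_A^*,q}(a)f=-l_A^*((D+qQ)(a))f$. Semi-direct products: $A\ltimes_{-l_A^*}V^*$ is $A\oplus V^*$ with $(a+f)\cdot(b+g)=a\cdot b-l_A^*(a)g-l_A^*(b)f$; it is an admissible commutative differential algebra with operators $D+\beta^*:a+f\mapsto D(a)+\beta^*(f)$ and $Q+\alpha^*:a+f\mapsto Q(a)+\alpha^*(f)$. A representation $(W,l,r)$ of a Novikov algebra $(A,\circ)$ consists of linear maps $l,r:A\to\mathrm{End}_{\mathbf{k}}(W)$ such that $(a+u)\circ(b+v)=a\circ b+l(a)v+r(b)u$ makes $A\oplus W$ a Novikov algebra, denoted $A\ltimes_{l,r}W$ (here with $A=(A,\circ_q)$); if $(V,l,r)$ is a representation so is $(V^*,l^*+r^*,-r^* )$. $\mathcal{O}$-operator on $(A,\cdot,D,Q)$ associated to $(V,l_A,\alpha,\beta)$: linear $T:V\to A$ with $DT=T\alpha$, $QT=T\beta$, $T(u)\cdot T(v)=T(l_A(T(u))v+l_A(T(v))u)$.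 $\mathcal{O}$-operator on a Novikov algebra $(A,\circ)$ associated to $(V,l,r)$: linear $T:V\to A$ with $T(u)\circ T(v)=T(l(T(u))v)+T(r(T(v))u)$. A linear map $T:V\to A$ is identified with $r_T\in A\otimes V^*\subseteq(A\oplus V^* )\otimes(A\oplus V^* )$ via $\mathrm{Hom}_{\mathbf{k}}(V,A)\cong A\otimes V^*$. For a binary operation $*$ and $r=\sum_i x_i\otimes y_i$: $r_{13}*r_{23}=\sum x_i\otimes x_j\otimes y_i*y_j$, $r_{12}*r_{23}=\sum x_i\otimes y_i*x_j\otimes y_j$, $r_{13}*r_{12}=\sum x_i*x_j\otimes y_j\otimes y_i$. NYBE in $(A,\circ)$: $r_{13}\circ r_{23}+r_{12}\star r_{23}+r_{13}\circ r_{12}=0$ with $a\star b=a\circ b+b\circ a$. Admissible associative Yang-Baxter equation in $(A,\cdot,D,Q)$: $r_{13}\cdot r_{12}+r_{13}\cdot r_{23}-r_{12}\cdot r_{23}=0$, $(D\otimes\mathrm{id}-\mathrm{id}\otimes Q)(r)=0$, $(\mathrm{id}\otimes D-Q\otimes\mathrm{id})(r)=0$. Antisymmetric: $\tau(r)=-r$. *)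

(* Defs.v *)
From HB Require Import structures.
From mathcomp Require Import all_boot all_algebra.

Set Implicit Arguments.
Unset Strict Implicit.
Unset Printing Implicit Defensive.

Import GRing.Theory.
Local Open Scope ring_scope.

Section LinearAlgebra.

Variable k : fieldType.
Implicit Types E F : vectType k.

Local Notation dual E := 'Hom(E, k^o).

Lemma linear_linfunE E F (f : E -> F) : linear f -> linfun f =1 f.
Proof.
move=> lin; pose L := GRing.isLinear.Build _ _ _ _ _ lin.
pose ff : {linear E -> F} := HB.pack f L.
exact: (lfunE ff).
Qed.

Lemma linear_sumE (U W : lmodType k) (f : U -> W) n (c : 'I_n -> k)
    (x : 'I_n -> U) :
  linear f -> f (\sum_i c i *: x i) = \sum_i c i *: f (x i).
Proof.
move=> lin; pose L := GRing.isLinear.Build _ _ _ _ _ lin.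
pose ff : {linear U -> W} := HB.pack f L.
rewrite -[LHS]/(ff _) linear_sum; apply: eq_bigr => i _.
exact: (linearZ_LR ff).
Qed.

Definition transpose E F (phi : 'Hom(E, F)) : 'Hom(dual F, dual E) :=
  linfun (fun f : dual F => (f \o phi)%VF : dual E).

Lemma transposeE E F (phi : 'Hom(E, F)) (f : dual F) (v : E) :
  transpose phi f v = f (phi v).
Proof.
rewrite /transpose linear_linfunE ?comp_lfunE // => a f1 f2.
by rewrite comp_lfunDl comp_lfunZl.
Qed.

Definition dual_rep E F (phi : 'Hom(E, 'End(F))) : 'Hom(E, 'End(dual F)) :=
  linfun (fun a : E => - transpose (phi a)).

Lemma dual_repE E F (phi : 'Hom(E, 'End(F))) (a : E) (f : dual F) (v : F) :
  dual_rep phi a f v = - f (phi a v).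
Proof.
rewrite /dual_rep linear_linfunE ?opp_lfunE ?transposeE // => c a1 a2.
apply/lfunP=> g; apply/lfunP=> w.
rewrite !(add_lfunE, scale_lfunE, opp_lfunE, transposeE).
by rewrite [phi _]linearP add_lfunE scale_lfunE [g _]linearP opprD scalerN.
Qed.

Definition direct_sum E F (f : 'End(E)) (g : 'End(F)) : 'End((E * F)%type) :=
  linfun (fun x : E * F => (f x.1, g x.2)).

Lemma direct_sumE E F (f : 'End(E)) (g : 'End(F)) (x : E * F) :
  direct_sum f g x = (f x.1, g x.2).
Proof.
rewrite /direct_sum linear_linfunE // => c x1 x2.
by congr (_, _); exact: linearP.
Qed.

(* The tensor product of finite-dimensional spaces is realised through the    *)
(* canonical isomorphism of E (x) F with Hom(E^*, F), under which x (x) y is  *)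
(* the map f |-> f(x) y. By tens_bilinear, tensor_liftE, tensor_lift_linear   *)
(* and tensor_decomp it has the universal property, so that the value on      *)
(* r = \sum_i x_i (x) y_i of an expression \sum_i b(x_i, y_i) with b bilinear *)
(* is tensor_lift b r, whatever the chosen decomposition (tensor_lift_sum).   *)
Definition tensor E F : vectType k := 'Hom(dual E, F).

Definition tens E F (x : E) (y : F) : tensor E F :=
  linfun (fun f : dual E => (f x : k) *: y).

Definition basis E (i : 'I_(\dim {:E})) : E := (vbasis {:E})`_i.

Definition cobasis E (i : 'I_(\dim {:E})) : dual E :=
  linfun (coord (vbasis {:E}) i : E -> k^o).

Definition tensor_lift E F (G : lmodType k) (b : E -> F -> G) (r : tensor E F) :
  G := \sum_i b (basis i) ((r : 'Hom(dual E, F)) (cobasis i)).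

Lemma tensE E F (x : E) (y : F) (f : dual E) :
  (tens x y : 'Hom(dual E, F)) f = (f x : k) *: y.
Proof.
rewrite /tens linear_linfunE // => c f1 f2.
by rewrite add_lfunE scale_lfunE scalerDl scalerA.
Qed.

Lemma cobasisE E (i : 'I_(\dim {:E})) (v : E) :
  cobasis i v = coord (vbasis {:E}) i v.
Proof.
by rewrite /cobasis linear_linfunE // => c v1 v2; rewrite linearP.
Qed.

Lemma basis_sum E (v : E) : v = \sum_i (cobasis i v : k) *: basis i.
Proof.
rewrite {1}(coord_vbasis (memvf v)).
by apply: eq_bigr => i _; rewrite cobasisE.
Qed.

Lemma cobasis_sum E (f : dual E) : f = \sum_i (f (basis i) : k) *: cobasis i.
Proof.
apply/lfunP=> v; rewrite {1}(basis_sum v) (linear_sumE _ _ (@linearP _ _ _ _ f)).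
by rewrite sum_lfunE; apply: eq_bigr => i _; rewrite scale_lfunE; exact: mulrC.
Qed.

Lemma tens_bilinear E F : bilinear_for *:%R *:%R (@tens E F).
Proof.
split=> [y c x1 x2|x c y1 y2]; apply/lfunP=> f;
  rewrite add_lfunE scale_lfunE !tensE.
  by rewrite [f _]linearP scalerDl scalerA.
by rewrite scalerDr !scalerA mulrC.
Qed.

Lemma tensor_liftE E F (G : lmodType k) (b : E -> F -> G) (x : E) (y : F) :
  bilinear_for *:%R *:%R b -> tensor_lift b (tens x y) = b x y.
Proof.
case=> bl br; rewrite {2}(basis_sum x) (linear_sumE _ _ (bl y)).
by apply: eq_bigr => i _; rewrite tensE (scalable_linear (br (basis i))).
Qed.

Lemma tensor_lift_linear E F (G : lmodType k) (b : E -> F -> G) :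
  bilinear_for *:%R *:%R b -> linear (tensor_lift b).
Proof.
case=> _ br c r1 r2; rewrite /tensor_lift scaler_sumr -big_split /=.
by apply: eq_bigr => i _; rewrite add_lfunE scale_lfunE br.
Qed.

Lemma tensor_decomp E F (r : tensor E F) :
  r = \sum_i tens (basis i) ((r : 'Hom(dual E, F)) (cobasis i)).
Proof.
apply/lfunP=> f; rewrite sum_lfunE {1}(cobasis_sum f).
rewrite (linear_sumE _ _ (@linearP _ _ _ _ (r : 'Hom(dual E, F)))).
by apply: eq_bigr => i _; rewrite tensE.
Qed.

Lemma tensor_lift_sum E F (G : lmodType k) (b : E -> F -> G) n
    (x : 'I_n -> E) (y : 'I_n -> F) : bilinear_for *:%R *:%R b ->
  tensor_lift b (\sum_i tens (x i) (y i)) = \sum_i b (x i) (y i).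
Proof.
move=> bb; transitivity (tensor_lift b (\sum_i 1 *: tens (x i) (y i))).
  by congr tensor_lift; apply: eq_bigr => i _; rewrite scale1r.
rewrite (linear_sumE _ _ (tensor_lift_linear bb)).
by apply: eq_bigr => i _; rewrite scale1r tensor_liftE.
Qed.

Definition tensor_map E F E' F' (f : E -> E') (g : F -> F') (r : tensor E F) :
  tensor E' F' := tensor_lift (fun x y => tens (f x) (g y)) r.

Definition tensor_swap E F (r : tensor E F) : tensor F E :=
  tensor_lift (fun x y => tens y x) r.

Definition hom_tensor E F (T : 'Hom(E, F)) : tensor F (dual E) :=
  \sum_i tens (T (basis i)) (cobasis i).

(* hom_tensor inverts the canonical map sending y (x) f to x |-> f(x) y.      *)
Definition tensor_hom E F (r : tensor F (dual E)) : 'Hom(E, F) :=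
  tensor_lift
    (fun (y : F) (f : dual E) => linfun (fun x : E => (f x : k) *: y)) r.

Lemma tensor_hom_bilinear E F :
  bilinear_for *:%R *:%R
    (fun (y : F) (f : dual E) => linfun (fun x : E => (f x : k) *: y)).
Proof.
have linE (y : F) (f : dual E) x :
    linfun (fun x : E => (f x : k) *: y) x = (f x : k) *: y.
  rewrite linear_linfunE // => c x1 x2.
  by rewrite [f _]linearP scalerDl scalerA.
split=> [f c y1 y2|y c f1 f2]; apply/lfunP=> x;
  rewrite add_lfunE scale_lfunE !linE.
  by rewrite scalerDr !scalerA mulrC.
by rewrite add_lfunE scale_lfunE scalerDl scalerA.
Qed.

Lemma tensor_homE E F (y : F) (f : dual E) (x : E) :
  tensor_hom (tens y f) x = (f x : k) *: y.
Proof.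
rewrite /tensor_hom tensor_liftE; last exact: tensor_hom_bilinear.
by rewrite linear_linfunE // => c x1 x2; rewrite [f _]linearP scalerDl scalerA.
Qed.

Lemma hom_tensorK E F : cancel (@hom_tensor E F) (@tensor_hom E F).
Proof.
move=> T; apply/lfunP=> x; rewrite /hom_tensor /tensor_hom tensor_lift_sum;
  last exact: tensor_hom_bilinear.
rewrite sum_lfunE [in RHS](basis_sum x) (linear_sumE _ _ (@linearP _ _ _ _ T)).
apply: eq_bigr => i _; rewrite linear_linfunE // => c x1 x2.
by rewrite [cobasis i _]linearP scalerDl scalerA.
Qed.

Lemma tensor_homK E F : cancel (@tensor_hom E F) (@hom_tensor E F).
Proof.
move=> r; apply/lfunP=> f; apply/lfunP=> x.
have tfE (T : 'Hom(E, F)) :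
    (hom_tensor T : 'Hom(dual F, dual E)) f x = f (T x).
  rewrite /hom_tensor !sum_lfunE [in RHS](basis_sum x).
  rewrite (linear_sumE _ _ (@linearP _ _ _ _ T)).
  rewrite (linear_sumE _ _ (@linearP _ _ _ _ f)).
  by apply: eq_bigr => i _; rewrite tensE scale_lfunE; exact: mulrC.
rewrite tfE /tensor_hom /tensor_lift sum_lfunE [in RHS](cobasis_sum f).
rewrite (linear_sumE _ _ (@linearP _ _ _ _ (r : 'Hom(dual F, dual E)))).
rewrite sum_lfunE; pose g i : dual E := (r : 'Hom(dual F, dual E)) (cobasis i).
transitivity (f (\sum_i (g i x : k) *: basis i)).
  congr (f _); apply: eq_bigr => i _; rewrite linear_linfunE // => c x1 x2.
  by rewrite -/(g i) (@linearP _ _ _ _ (g i)) scalerDl scalerA.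
rewrite (linear_sumE _ _ (@linearP _ _ _ _ f)).
by apply: eq_bigr => i _; rewrite scale_lfunE; exact: mulrC.
Qed.

End LinearAlgebra.

Section Novikov.

Variable k : fieldType.
Implicit Types A V : vectType k.

Local Notation dual E := 'Hom(E, k^o).

Record novikov_algebra A (op : A -> A -> A) : Prop := {
  novikov_bilinear : bilinear_for *:%R *:%R op;
  novikov_left_symmetric : forall a b c,
    op (op a b) c - op a (op b c) = op (op b a) c - op b (op a c);
  novikov_right_commutative : forall a b c, op (op a b) c = op (op a c) b
}.

Record adm_comm_diff_algebra A (mul : A -> A -> A) (D Q : 'End(A)) : Prop := {
  adm_bilinear : bilinear_for *:%R *:%R mul;
  adm_commutative : commutative mul;
  adm_associative : associative mul;
  adm_derivation : forall a b, D (mul a b) = mul (D a) b + mul a (D b);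
  adm_admissible : forall a b, Q (mul a b) = mul (Q a) b - mul a (D b)
}.

Definition induced_op A (mul : A -> A -> A) (D Q : 'End(A)) (q : k) :
  A -> A -> A := fun a b => mul a ((D + q *: Q) b).

Record adm_rep A (mul : A -> A -> A) (D Q : 'End(A)) V
    (l : 'Hom(A, 'End(V))) (alpha beta : 'End(V)) : Prop := {
  adm_rep_mul : forall a b v, l (mul a b) v = l a (l b v);
  adm_rep_alpha : forall a v, alpha (l a v) = l (D a) v + l a (alpha v);
  adm_rep_betaD : forall a v, beta (l a v) = l a (beta v) - l (D a) v;
  adm_rep_betaQ : forall a v, beta (l a v) = l (Q a) v - l a (alpha v)
}.

Definition induced_l A V (l : 'Hom(A, 'End(V))) (alpha beta : 'End(V)) (q : k) :
    'Hom(A, 'End(V)) :=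
  linfun (fun a : A => (l a \o (alpha + q *: beta))%VF).

Lemma induced_lE A V (l : 'Hom(A, 'End(V))) alpha beta q (a : A) (v : V) :
  induced_l l alpha beta q a v = l a ((alpha + q *: beta) v).
Proof.
rewrite /induced_l linear_linfunE ?comp_lfunE // => c a1 a2.
by rewrite [l _]linearP comp_lfunDl comp_lfunZl.
Qed.

Definition induced_r A V (l : 'Hom(A, 'End(V))) (D Q : 'End(A)) (q : k) :
  'Hom(A, 'End(V)) := (l \o (D + q *: Q))%VF.

Definition semidirect A V (op : A -> A -> A) (l r : 'Hom(A, 'End(V))) :
    (A * V)%type -> (A * V)%type -> (A * V)%type :=
  fun x y => (op x.1 y.1, l x.1 y.2 + r y.1 x.2).

Definition novikov_rep A V (op : A -> A -> A) (l r : 'Hom(A, 'End(V))) : Prop :=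
  novikov_algebra (semidirect op l r).

Record adm_O_operator A (mul : A -> A -> A) (D Q : 'End(A)) V
    (l : 'Hom(A, 'End(V))) (alpha beta : 'End(V)) (T : 'Hom(V, A)) : Prop := {
  adm_O_alpha : forall v, D (T v) = T (alpha v);
  adm_O_beta : forall v, Q (T v) = T (beta v);
  adm_O_mul : forall u v, mul (T u) (T v) = T (l (T u) v + l (T v) u)
}.

Definition novikov_O_operator A V (op : A -> A -> A) (l r : 'Hom(A, 'End(V)))
    (T : 'Hom(V, A)) : Prop :=
  forall u v, op (T u) (T v) = T (l (T u) v) + T (r (T v) u).

Definition prod_r13_r23 A (op : A -> A -> A) (r : tensor A A) :
    tensor A (tensor A A) :=
  tensor_lift (fun xi yi =>
    tensor_lift (fun xj yj => tens xi (tens xj (op yi yj))) r) r.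

Definition prod_r12_r23 A (op : A -> A -> A) (r : tensor A A) :
    tensor A (tensor A A) :=
  tensor_lift (fun xi yi =>
    tensor_lift (fun xj yj => tens xi (tens (op yi xj) yj)) r) r.

Definition prod_r13_r12 A (op : A -> A -> A) (r : tensor A A) :
    tensor A (tensor A A) :=
  tensor_lift (fun xi yi =>
    tensor_lift (fun xj yj => tens (op xi xj) (tens yj yi)) r) r.

Definition antisymmetric_tensor A (r : tensor A A) : Prop := tensor_swap r = - r.

Definition NYBE A (op : A -> A -> A) (r : tensor A A) : Prop :=
  prod_r13_r23 op r + prod_r12_r23 (fun a b => op a b + op b a) r
    + prod_r13_r12 op r = 0.

Definition adm_AYBE A (mul : A -> A -> A) (D Q : 'End(A)) (r : tensor A A) :
    Prop :=
  [/\ prod_r13_r12 mul r + prod_r13_r23 mul r - prod_r12_r23 mul r = 0,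
      tensor_map D id r - tensor_map id Q r = 0
    & tensor_map id D r - tensor_map Q id r = 0].

Definition antisymmetric_NYBE_solution A (op : A -> A -> A) (r : tensor A A) :
    Prop :=
  [/\ novikov_algebra op, antisymmetric_tensor r & NYBE op r].

Definition antisymmetric_adm_AYBE_solution A (mul : A -> A -> A) (D Q : 'End(A))
    (r : tensor A A) : Prop :=
  [/\ adm_comm_diff_algebra mul D Q, antisymmetric_tensor r
    & adm_AYBE mul D Q r].

(* r_T, carried along the inclusion of A (x) V^* into the tensor square of    *)
(* A (+) V^*.                                                                 *)
Definition operator_tensor A V (T : 'Hom(V, A)) :
    tensor (A * dual V)%type (A * dual V)%type :=
  tensor_map (fun a : A => (a, 0 : dual V)) (fun f : dual V => (0 : A, f))
    (hom_tensor T).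

End Novikov.

(* Main.v *)
(* An admissible commutative differential algebra induces a Novikov algebra,
   and semidirect products carry representations of the former to
   representations of the latter.  The equality of the two dual
   representations holds up to the term (1 + 2q) l(a)(alpha + beta)(v), which
   is where q = -1/2 comes from.

   Writing r = r_T - tau r_T on a basis of V, the transposition identity
   sum_i e_i (x) phi^*(e^i) = sum_i phi(e_i) (x) e^i turns each term of the
   associative Yang-Baxter equation into one in which only T(l(T e_i) e_j)
   occurs, and these cancel by the O-operator identity.

   In any admissible algebra, (D (x) id)(r) = (id (x) Q)(r) and
   (id (x) D)(r) = (Q (x) id)(r) let one move D + qQ off the products
   r_13 o r_23 and r_13 o r_12, where it reappears as Q + qD on the middle
   factor.  Hence the Novikov Yang-Baxter tensor is the image of the
   associative one under id (x) (Q + qD) (x) id, up to the term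
   (1 + 2q) a(D + Q)(b) in the middle factor. *)

Require Import Defs.
From HB Require Import structures.
From mathcomp Require Import all_boot all_algebra.
From mathcomp Require Import ring.

Set Implicit Arguments.
Unset Strict Implicit.
Unset Printing Implicit Defensive.

Import GRing.Theory.
Local Open Scope ring_scope.

(** * Linear calculus on tensors and transposition identities on a basis *)

Section Tensors.

Variable k : fieldType.
Implicit Types E F : vectType k.

Local Notation dual E := 'Hom(E, k^o).
Local Notation bilin := (bilinear_for *:%R *:%R).

Lemma tens_linearl E F (y : F) : linear (fun x : E => tens x y).
Proof. exact: (tens_bilinear E F).1. Qed.

Lemma tens_linearr E F (x : E) : linear (@tens k E F x).
Proof. exact: (tens_bilinear E F).2. Qed.

Lemma linear_fun0 (U W : lmodType k) (f : U -> W) : linear f -> f 0 = 0.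
Proof.
by move=> lf; have := lf (-1) 0 0; rewrite scaler0 add0r scaleN1r addNr.
Qed.

Lemma linear_funN (U W : lmodType k) (f : U -> W) x :
  linear f -> f (- x) = - f x.
Proof.
by move=> lf; have := lf (-1) x 0; rewrite (linear_fun0 lf) !addr0 !scaleN1r.
Qed.

Lemma linear_funD (U W : lmodType k) (f : U -> W) x y :
  linear f -> f (x + y) = f x + f y.
Proof. by move=> lf; have := lf 1 x y; rewrite !scale1r. Qed.

Lemma eq_tensor_lift E F (G : lmodType k) (b b' : E -> F -> G) r :
  b =2 b' -> tensor_lift b r = tensor_lift b' r.
Proof. by move=> eb; apply: eq_bigr. Qed.

Lemma tensor_liftD E F (G : lmodType k) (b b' : E -> F -> G) r :
  tensor_lift (fun x y => b x y + b' x y) r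
    = tensor_lift b r + tensor_lift b' r.
Proof. exact: big_split. Qed.

Lemma tensor_lift0 E F (G : lmodType k) (b : E -> F -> G) r :
  (forall x y, b x y = 0) -> tensor_lift b r = 0.
Proof. by move=> b0; apply: big1. Qed.

Lemma linear_tensor_lift E F (G H : lmodType k) (f : G -> H) (b : E -> F -> G)
    r : linear f -> f (tensor_lift b r) = tensor_lift (fun x y => f (b x y)) r.
Proof.
move=> lf; pose L := GRing.isLinear.Build _ _ _ _ _ lf.
pose ff : {linear G -> H} := HB.pack f L.
exact: (linear_sum ff).
Qed.

(** Makes a nested lift a legitimate argument of an outer lift. *)
Lemma bilinear_tensor_lift E F E' F' (G : lmodType k)
    (b : E -> F -> E' -> F' -> G) (r : tensor E' F') :
    (forall x' y', bilin (fun x y => b x y x' y')) ->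
  bilin (fun x y => tensor_lift (b x y) r).
Proof.
move=> bb; split=> [y c x1 x2|x c y1 y2] /=;
  rewrite /tensor_lift scaler_sumr -big_split; apply: eq_bigr => i _.
  by rewrite ((bb _ _).1).
by rewrite ((bb _ _).2).
Qed.

Lemma tensor_lift_map E F E' F' (G : lmodType k) (b : E' -> F' -> G)
    (f : E -> E') (g : F -> F') r : bilin b ->
  tensor_lift b (tensor_map f g r) = tensor_lift (fun x y => b (f x) (g y)) r.
Proof. by move=> bb; apply: tensor_lift_sum. Qed.

Lemma tensor_lift_swap E F (G : lmodType k) (b : F -> E -> G) (r : tensor E F) :
  bilin b -> tensor_lift b (tensor_swap r) = tensor_lift (fun x y => b y x) r.
Proof. by move=> bb; apply: tensor_lift_sum. Qed.

Lemma bilinear_flip E F (G : lmodType k) (b : E -> F -> G) :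
  bilin b -> bilin (fun y x => b x y).
Proof. by case=> bl br; split. Qed.

Lemma tensor_map_bilinear E F E' F' (f : E -> E') (g : F -> F') :
  linear f -> linear g -> bilin (fun x y => tens (f x) (g y)).
Proof.
by move=> lf lg; split=> [y c x1 x2|x c y1 y2];
  rewrite (lf, lg) (tens_linearl, tens_linearr).
Qed.

Lemma tensor_map_linear E F E' F' (f : E -> E') (g : F -> F') :
  linear f -> linear g -> linear (tensor_map f g).
Proof.
by move=> lf lg; apply: tensor_lift_linear; apply: tensor_map_bilinear.
Qed.

Lemma tensor_mapE E F E' F' (f : E -> E') (g : F -> F') x y :
  linear f -> linear g -> tensor_map f g (tens x y) = tens (f x) (g y).
Proof.
move=> lf lg; rewrite /tensor_map (tensor_liftE x y) //.
exact: tensor_map_bilinear.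
Qed.

Lemma tensor_swap_linear E F : linear (@tensor_swap k E F).
Proof.
by apply: tensor_lift_linear; apply: bilinear_flip; apply: tens_bilinear.
Qed.

Lemma tensor_swapK E F : cancel (@tensor_swap k E F) (@tensor_swap k F E).
Proof.
move=> r; rewrite {1}/tensor_swap tensor_lift_swap; last first.
  by apply: bilinear_flip; apply: tens_bilinear.
exact/esym/tensor_decomp.
Qed.

Lemma antisymmetrize_antisymmetric E (r : tensor E E) :
  antisymmetric_tensor (r - tensor_swap r).
Proof.
rewrite /antisymmetric_tensor (linear_funD _ _ (@tensor_swap_linear _ _)).
by rewrite (linear_funN _ (@tensor_swap_linear _ _)) tensor_swapK opprB addrC.
Qed.

(** Expand the transpose of [phi] at e^i as the sum over j of e^i(phi e_j) e^j; after exchanging the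
    sums, the sum over i of e^i(phi e_j) e_i is phi e_j. *)
Lemma sum_cobasis_transpose E (G : lmodType k) (phi : 'End(E))
    (b : E -> dual E -> G) : bilin b ->
  \sum_i b (basis i) (transpose phi (cobasis i))
    = \sum_i b (phi (basis i)) (cobasis i).
Proof.
move=> [bl br].
under eq_bigr => i _.
  rewrite [transpose _ _]cobasis_sum (linear_sumE _ _ (br _)).
  under eq_bigr => j _ do rewrite transposeE.
  over.
rewrite exchange_big; apply: eq_bigr => j _.
by rewrite [phi _ in RHS]basis_sum (linear_sumE _ _ (bl _)).
Qed.

(** This and the next three lemmas specialise the transposition identity: either order of the two
    legs, with or without a fixed first factor. *)
Lemma sum_tens_transpose E F F' (phi : 'End(E)) (f : E -> F)
    (g : dual E -> F') : linear f -> linear g ->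
  \sum_i tens (f (basis i)) (g (transpose phi (cobasis i)))
    = \sum_i tens (f (phi (basis i))) (g (cobasis i)).
Proof.
by move=> lf lg; exact: (sum_cobasis_transpose phi (tensor_map_bilinear lf lg)).
Qed.

Lemma sum_tens_transpose_flip E F F' (phi : 'End(E)) (f : E -> F)
    (g : dual E -> F') : linear f -> linear g ->
  \sum_i tens (g (transpose phi (cobasis i))) (f (basis i))
    = \sum_i tens (g (cobasis i)) (f (phi (basis i))).
Proof.
move=> lf lg.
exact: (sum_cobasis_transpose phi (bilinear_flip (tensor_map_bilinear lg lf))).
Qed.

Lemma sum_tens_tens_transpose E F F' (H : vectType k) (z : H)
    (phi : 'End(E)) (f : E -> F) (g : dual E -> F') : linear f -> linear g ->
  \sum_i tens z (tens (f (basis i)) (g (transpose phi (cobasis i))))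
    = \sum_i tens z (tens (f (phi (basis i))) (g (cobasis i))).
Proof.
move=> lf lg; have lz := @tens_linearr H (tensor F F') z.
have bb := tensor_map_bilinear lf lg.
apply: (sum_cobasis_transpose phi (b := fun x y => tens z (tens (f x) (g y)))).
by split=> [y c x1 x2|x c y1 y2] /=; rewrite (bb.1, bb.2) lz.
Qed.

Lemma sum_tens_tens_transpose_flip E F F' (H : vectType k) (z : H)
    (phi : 'End(E)) (f : E -> F) (g : dual E -> F') : linear f -> linear g ->
  \sum_i tens z (tens (g (transpose phi (cobasis i))) (f (basis i)))
    = \sum_i tens z (tens (g (cobasis i)) (f (phi (basis i)))).
Proof.
move=> lf lg; have lz := @tens_linearr H (tensor F' F) z.
have bb := tensor_map_bilinear lg lf.
apply: (sum_cobasis_transpose phi (b := fun x y => tens z (tens (g y) (f x)))).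
by split=> [y c x1 x2|x c y1 y2] /=; rewrite (bb.1, bb.2) lz.
Qed.

(** Coordinate functionals separate points. Their laws are given as hypotheses on a bare map to [k],
    ready for use as rewrite rules. *)
Lemma functional_ext E (u v : E) :
    (forall f : E -> k, (forall x y, f (x + y) = f x + f y) ->
       (forall x, f (- x) = - f x) -> (forall c x, f (c *: x) = c * f x) ->
       f 0 = 0 -> f u = f v) ->
  u = v.
Proof.
move=> eq_f; rewrite [u]basis_sum [v]basis_sum.
apply: eq_bigr => i _; congr (_ *: _).
apply: (eq_f (cobasis i)) => [x y|x|c x|].
- exact: (linearD (cobasis i)).
- exact: (linearN (cobasis i)).
- exact: (linearZ_LR (cobasis i)).
- exact: (linear0 (cobasis i)).
Qed.

End Tensors.


(* Identities in a vector space are checked on functionals, whose values are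
   scalars on which [ring] applies. *)
Ltac vect_ring :=
  let fD := fresh "fD" in let fN := fresh "fN" in
  let fZ := fresh "fZ" in let f0 := fresh "f0" in
  apply: functional_ext => ? fD fN fZ f0; rewrite ?(fD, fN, fZ, f0); ring.

Section Novikov.

Variable k : fieldType.
Implicit Types A V : vectType k.

Local Notation dual E := 'Hom(E, k^o).
Local Notation bilin := (bilinear_for *:%R *:%R).

Lemma shift_lfunE A (D Q : 'End(A)) (q : k) a :
  (D + q *: Q) a = D a + q *: Q a.
Proof. by rewrite add_lfunE scale_lfunE. Qed.

(** * The Novikov product of an admissible algebra *)

Section AdmissibleAlgebra.

Variables (A : vectType k) (mul : A -> A -> A) (D Q : 'End(A)).
Hypothesis hA : adm_comm_diff_algebra mul D Q.

Local Notation mulC := (adm_commutative hA).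
Local Notation mulA := (adm_associative hA).

Lemma adm_linearl b : linear (mul^~ b).
Proof. exact: (adm_bilinear hA).1. Qed.

Lemma adm_linearr a : linear (mul a).
Proof. exact: (adm_bilinear hA).2. Qed.

Lemma adm_mulDl a b c : mul (a + b) c = mul a c + mul b c.
Proof. by rewrite (linear_funD _ _ (adm_linearl c)). Qed.

Lemma adm_mulDr a b c : mul a (b + c) = mul a b + mul a c.
Proof. by rewrite (linear_funD _ _ (adm_linearr a)). Qed.

Lemma adm_mulZr a c b : mul a (c *: b) = c *: mul a b.
Proof.
by have := adm_linearr a c b 0; rewrite (linear_fun0 (adm_linearr a)) !addr0.
Qed.

Lemma adm_mulZl a c b : mul (c *: a) b = c *: mul a b.
Proof. by rewrite mulC adm_mulZr mulC. Qed.

Lemma adm_shift (q : k) a b :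
  (D + q *: Q) (mul a b) = mul ((D + q *: Q) a) b + (1 - q) *: mul a (D b).
Proof.
rewrite !shift_lfunE (adm_derivation hA) (adm_admissible hA).
rewrite adm_mulDl adm_mulZl.
vect_ring.
Qed.

Lemma induced_novikov q : novikov_algebra (induced_op mul D Q q).
Proof.
rewrite /induced_op; split=> [|a b c|a b c].
- split=> [b c a1 a2|a c b1 b2]; first exact: adm_linearl.
  by rewrite linearP adm_linearr.
(* The associator is -(1 - q) x y D((D + qQ) c), symmetric in x and y by commutativity. *)
- have E x y : mul (mul x ((D + q *: Q) y)) ((D + q *: Q) c)
      - mul x ((D + q *: Q) (mul y ((D + q *: Q) c)))
      = - ((1 - q) *: mul (mul x y) (D ((D + q *: Q) c))).
    by rewrite adm_shift adm_mulDr adm_mulZr !mulA opprD addNKr.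
  by rewrite !E [mul b a]mulC.
- by rewrite -!mulA; congr (mul _ _); exact: mulC.
Qed.

(** By commutativity the expansions of [Q (mul a b)] and [Q (mul b a)] agree; rearranging them gives
    the symmetry. *)
Lemma adm_shift_symmetric a b : mul ((D + Q) a) b = mul a ((D + Q) b).
Proof.
rewrite !add_lfunE adm_mulDl adm_mulDr; apply/eqP; rewrite -subr_eq0.
have := adm_admissible hA b a; rewrite mulC (adm_admissible hA) => /eqP.
rewrite -subr_eq0 [mul (Q b) a]mulC [mul b (D a)]mulC => /eqP E.
apply/eqP; rewrite -[RHS]E; vect_ring.
Qed.

End AdmissibleAlgebra.
(** The sign built into [dual_rep] cancels, which leaves plain transposes. *)
Lemma opp_dual_repE A V (l : 'Hom(A, 'End(V))) a :
  (- dual_rep l) a = transpose (l a).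
Proof.
apply/lfunP=> f; apply/lfunP=> v.
by rewrite !opp_lfunE dual_repE opprK transposeE.
Qed.

(** * Representations, their semidirect products and duals *)

Section Representation.

Variables (A V : vectType k) (mul : A -> A -> A) (D Q : 'End(A)).
Variables (l : 'Hom(A, 'End(V))) (alpha beta : 'End(V)).
Hypotheses (hA : adm_comm_diff_algebra mul D Q)
  (hV : adm_rep mul D Q l alpha beta).

Lemma rep_linearE c a b v : l (c *: a + b) v = c *: l a v + l b v.
Proof. by rewrite [l _]linearP add_lfunE scale_lfunE. Qed.

(** Equate the two values that the axioms for [beta] give to [beta (l a v)]. *)
Lemma rep_Q a v : l (Q a) v = l a (alpha v) + l a (beta v) - l (D a) v.
Proof.
have := adm_rep_betaQ hV a v; rewrite (adm_rep_betaD hV) => e.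
by rewrite -(subrK (l a (alpha v)) (l (Q a) v)) -e; vect_ring.
Qed.

Lemma rep_comm a b v : l a (l b v) = l b (l a v).
Proof. by rewrite -!(adm_rep_mul hV) (adm_commutative hA). Qed.

Lemma adm_semidirect :
  adm_comm_diff_algebra (semidirect mul l l) (direct_sum D alpha)
    (direct_sum Q beta).
Proof.
split.
- split=> [y c x1 x2|x c y1 y2]; apply: injective_projections => /=;
    rewrite ?(adm_linearl hA, adm_linearr hA) // !(rep_linearE, linearP);
    by vect_ring.
- by move=> x y; rewrite /semidirect (adm_commutative hA) addrC.
- move=> x y z; apply: injective_projections => /=.
    exact: (adm_associative hA).
  rewrite !(adm_rep_mul hV) !linearD /= [l z.1 (l x.1 _)]rep_comm.
  by rewrite [l z.1 (l y.1 _)]rep_comm addrA.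
- move=> x y; rewrite !direct_sumE; apply: injective_projections => /=.
    exact: (adm_derivation hA).
  by rewrite !linearD /= !(adm_rep_alpha hV); vect_ring.
- move=> x y; rewrite !direct_sumE; apply: injective_projections => /=.
    exact: (adm_admissible hA).
  (* Each axiom for [beta] handles one of the two summands of the product. *)
  rewrite !linearD /= (adm_rep_betaQ hV x.1) (adm_rep_betaD hV y.1).
  vect_ring.
Qed.

(** Transposition reverses composition, so the axiom for [alpha] and the [D] axiom for [beta] trade
    places, while the [Q] axiom is carried to itself. Commutativity absorbs the reversed order of
    products. *)
Lemma adm_rep_dual :
  adm_rep mul D Q (- dual_rep l) (transpose beta) (transpose alpha).
Proof.
have E a f v : (- dual_rep l) a f v = f (l a v).
  by rewrite opp_dual_repE transposeE.
split=> [a b f|a f|a f|a f]; apply/lfunP=> v;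
  rewrite ?(E, transposeE, add_lfunE, opp_lfunE).
- by rewrite (adm_commutative hA) (adm_rep_mul hV).
- by rewrite (adm_rep_betaD hV) linearB /= addrC subrK.
- by rewrite (adm_rep_alpha hV) linearD /= addrC addKr.
- by rewrite (adm_rep_betaQ hV) linearB /= opprB addrC subrK.
Qed.

(** Through this identity the Novikov representation axioms follow from [induced_novikov] applied to
    the semidirect product. *)
Lemma induced_semidirect q x y :
  induced_op (semidirect mul l l) (direct_sum D alpha) (direct_sum Q beta) q x y
    = semidirect (induced_op mul D Q q) (induced_l l alpha beta q)
        (induced_r l D Q q) x y.
Proof.
rewrite /induced_op /induced_r /semidirect induced_lE comp_lfunE.
by rewrite !shift_lfunE !direct_sumE.
Qed.

(** [T] intertwines alpha + q beta with D + qQ, so the claim is the associative identity at u and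
    (alpha + q beta) v. *)
Lemma induced_O_operator q (T : 'Hom(V, A)) :
    adm_O_operator mul D Q l alpha beta T ->
  novikov_O_operator (induced_op mul D Q q) (induced_l l alpha beta q)
    (induced_r l D Q q) T.
Proof.
move=> hT u v; rewrite /induced_op /induced_r induced_lE comp_lfunE.
have -> : (D + q *: Q) (T v) = T ((alpha + q *: beta) v).
  by rewrite !shift_lfunE (adm_O_alpha hT) (adm_O_beta hT) linearD linearZ.
by rewrite (adm_O_mul hT) linearD.
Qed.

End Representation.

Lemma eq_novikov_algebra A (op op' : A -> A -> A) :
  op =2 op' -> novikov_algebra op -> novikov_algebra op'.
Proof.
move=> e [[bl br] ls rc]; split=> [|a b c|a b c]; rewrite -?e //.
  by split=> [y c x1 x2|x c y1 y2] /=; rewrite -!e ?bl ?br.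
Qed.

Lemma eq_NYBE A (op op' : A -> A -> A) r :
  op =2 op' -> NYBE op r -> NYBE op' r.
Proof.
move=> e; rewrite /NYBE; congr (_ + _ + _ = 0);
  apply: eq_tensor_lift => ? ?; apply: eq_tensor_lift => ? ?;
  by rewrite ?e.
Qed.

(** * From the associative to the Novikov Yang-Baxter equation *)

Section AssociativeToNovikov.

Variables (A : vectType k) (mul : A -> A -> A) (D Q : 'End(A)).
Hypothesis hA : adm_comm_diff_algebra mul D Q.

Lemma tensor_map_shiftl (F F' : vectType k) (g : F -> F') (D' Q' : 'End(A))
    (q : k) r :
  tensor_map (D' + q *: Q') g r = tensor_map D' g r + q *: tensor_map Q' g r.
Proof.
rewrite /tensor_map /tensor_lift scaler_sumr -big_split; apply: eq_bigr => i _.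
by rewrite shift_lfunE addrC tens_linearl addrC.
Qed.

Lemma tensor_map_shiftr (F F' : vectType k) (g : F -> F') (D' Q' : 'End(A))
    (q : k) r :
  tensor_map g (D' + q *: Q') r = tensor_map g D' r + q *: tensor_map g Q' r.
Proof.
rewrite /tensor_map /tensor_lift scaler_sumr -big_split; apply: eq_bigr => i _.
by rewrite shift_lfunE addrC tens_linearr addrC.
Qed.

Lemma NYBE_defect q a b :
  mul a ((D + q *: Q) b) + mul b ((D + q *: Q) a) + (Q + q *: D) (mul a b)
    = (1 + 2 * q) *: mul a ((D + Q) b).
Proof.
(* With [mul (Q a) b] eliminated, both sides expand in [mul a (D b)], [mul a (Q b)] and
   [mul (D a) b]. *)
have e : mul (Q a) b = mul a (D b) + mul a (Q b) - mul (D a) b.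
  rewrite -(adm_mulDr hA) -(add_lfunE D) -adm_shift_symmetric //.
  by rewrite add_lfunE (adm_mulDl hA) addrC addKr.
rewrite [mul b _](adm_commutative hA) !shift_lfunE add_lfunE.
rewrite (adm_derivation hA) (adm_admissible hA).
rewrite !(adm_mulDl hA, adm_mulDr hA, adm_mulZl hA, adm_mulZr hA) e.
vect_ring.
Qed.

Lemma NYBE_of_adm_AYBE q r :
    (forall a b, (1 + 2 * q) *: mul a ((D + Q) b) = 0) ->
  adm_AYBE mul D Q r -> NYBE (induced_op mul D Q q) r.
Proof.
move=> defect0 [aybe /subr0_eq eD /subr0_eq eQ].
set del := D + q *: Q; pose eps := Q + q *: D.
(* The relations on r turn D (x) id into id (x) Q and Q (x) id into id (x) D, which puts q on [D] in
   [eps]. *)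
have tmap_del1 : tensor_map del id r = tensor_map id eps r.
  by rewrite tensor_map_shiftl tensor_map_shiftr eD eQ.
have tmap_del2 : tensor_map id del r = tensor_map eps id r.
  by rewrite tensor_map_shiftl tensor_map_shiftr eD eQ.
have move1 (G : lmodType k) (b : A -> A -> G) : bilin b ->
    tensor_lift (fun x y => b (del x) y) r
      = tensor_lift (fun x y => b x (eps y)) r.
  move=> bb; have := tensor_lift_map del id r bb; rewrite tmap_del1 => <-.
  exact: tensor_lift_map.
have move2 (G : lmodType k) (b : A -> A -> G) : bilin b ->
    tensor_lift (fun x y => b x (del y)) r
      = tensor_lift (fun x y => b (eps x) y) r.
  move=> bb; have := tensor_lift_map id del r bb; rewrite tmap_del2 => <-.
  exact: tensor_lift_map.
have lin_id (E : vectType k) : linear (id : E -> E) by [].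
have lin_eps : linear eps by exact: linearP.
have lin_map := tensor_map_linear lin_eps (lin_id A).
pose Theta := tensor_map (id : A -> A) (tensor_map eps (id : A -> A)).
have ThetaP : linear Theta by exact: tensor_map_linear.
have ThetaE x y z : Theta (tens x (tens y z)) = tens x (tens (eps y) z).
  by rewrite /Theta !tensor_mapE.
have e13_23 : prod_r13_r23 (induced_op mul D Q q) r
    = Theta (prod_r13_r23 mul r).
  rewrite /prod_r13_r23 (linear_tensor_lift _ _ ThetaP).
  apply: eq_tensor_lift => xi yi; rewrite (linear_tensor_lift _ _ ThetaP).
  (* The operator sits on y_j, whose partner x_j is the middle factor; in r_13 o r_12 the roles of
     x_j and y_j are exchanged. *)
  rewrite (move2 _ (fun x y => tens xi (tens x (mul yi y)))).
    by apply: eq_tensor_lift => xj yj; rewrite ThetaE.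
  by split=> [y c x1 x2|x c y1 y2] /=;
    rewrite ?(adm_linearr hA) ?(tens_linearl, tens_linearr).
have e13_12 : prod_r13_r12 (induced_op mul D Q q) r
    = Theta (prod_r13_r12 mul r).
  rewrite /prod_r13_r12 (linear_tensor_lift _ _ ThetaP).
  apply: eq_tensor_lift => xi yi; rewrite (linear_tensor_lift _ _ ThetaP).
  rewrite (move1 _ (fun x y => tens (mul xi x) (tens y yi))).
    by apply: eq_tensor_lift => xj yj; rewrite ThetaE.
  by split=> [y c x1 x2|x c y1 y2] /=;
    rewrite ?(adm_linearr hA) ?(tens_linearl, tens_linearr).
have e12_23 : prod_r12_r23
      (fun a b => induced_op mul D Q q a b + induced_op mul D Q q b a) r
    = - Theta (prod_r12_r23 mul r).
  (* The product is itself the middle factor, so the sum vanishes term by term, by [NYBE_defect]. *)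
  apply/eqP; rewrite -addr_eq0; apply/eqP.
  rewrite /prod_r12_r23 (linear_tensor_lift _ _ ThetaP) -tensor_liftD.
  apply: tensor_lift0 => xi yi; rewrite (linear_tensor_lift _ _ ThetaP).
  rewrite -tensor_liftD; apply: tensor_lift0 => xj yj; rewrite ThetaE.
  rewrite -(linear_funD _ _ (tens_linearr _)).
  rewrite -(linear_funD _ _ (tens_linearl _)).
  rewrite NYBE_defect defect0 (linear_fun0 (tens_linearl _)).
  exact: linear_fun0 (tens_linearr _).
have := congr1 Theta aybe; rewrite !(linear_funD _ _ ThetaP).
rewrite (linear_funN _ ThetaP) (linear_fun0 ThetaP) /NYBE e13_23 e13_12 e12_23.
by move=> e; rewrite addrAC [Theta _ + Theta _]addrC.
Qed.

End AssociativeToNovikov.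

(* The situation of [A (+) V^*] with the semidirect product structure: [iA]
   plays the role of [v |-> (T v, 0)] and [iC] that of [f |-> (0, f)]. *)
Section SkewSolution.

Variables (B V : vectType k) (mul : B -> B -> B) (D Q : 'End(B)).
Variables (L : V -> 'End(V)) (alpha beta : 'End(V)).
Variables (iA : V -> B) (iC : dual V -> B).
Hypotheses (iA_linear : linear iA) (iC_linear : linear iC).
Hypothesis mul_bilinear : bilin mul.
Hypothesis mulAA : forall u v, mul (iA u) (iA v) = iA (L u v) + iA (L v u).
Hypothesis mulAC : forall u f, mul (iA u) (iC f) = iC (transpose (L u) f).
Hypothesis mulCA : forall u f, mul (iC f) (iA u) = iC (transpose (L u) f).
Hypothesis mulCC : forall f g, mul (iC f) (iC g) = 0.
Hypothesis DA : forall v, D (iA v) = iA (alpha v).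
Hypothesis DC : forall f, D (iC f) = iC (transpose beta f).
Hypothesis QA : forall v, Q (iA v) = iA (beta v).
Hypothesis QC : forall f, Q (iC f) = iC (transpose alpha f).

Let t : tensor B B := \sum_i tens (iA (basis i)) (iC (cobasis i)).

Lemma tensor_lift_skew (G : lmodType k) (b : B -> B -> G) : bilin b ->
  tensor_lift b (t - tensor_swap t)
    = \sum_i b (iA (basis i)) (iC (cobasis i))
      - \sum_i b (iC (cobasis i)) (iA (basis i)).
Proof.
move=> bb; have lin := tensor_lift_linear bb.
rewrite (linear_funD _ _ lin) (linear_funN _ lin) tensor_lift_swap //.
by rewrite !tensor_lift_sum //; exact: bilinear_flip.
Qed.

(** An expression quadratic in r splits into four blocks, each copy of r contributing [t] or minus
    its swap. *)
Lemma tensor_lift2_skew (G : lmodType k) (b : B -> B -> B -> B -> G) :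
    (forall x' y', bilin (fun x y => b x y x' y')) ->
    (forall x y, bilin (b x y)) ->
  tensor_lift (fun x y => tensor_lift (b x y) (t - tensor_swap t))
      (t - tensor_swap t)
    = \sum_i \sum_j b (iA (basis i)) (iC (cobasis i))
                      (iA (basis j)) (iC (cobasis j))
      - \sum_i \sum_j b (iA (basis i)) (iC (cobasis i))
                        (iC (cobasis j)) (iA (basis j))
      - (\sum_i \sum_j b (iC (cobasis i)) (iA (basis i))
                         (iA (basis j)) (iC (cobasis j))
         - \sum_i \sum_j b (iC (cobasis i)) (iA (basis i))
                           (iC (cobasis j)) (iA (basis j))).
Proof.
move=> b1 b2; rewrite tensor_lift_skew; last exact: bilinear_tensor_lift.
rewrite -!sumrB; apply: eq_bigr => i _.
by rewrite !tensor_lift_skew // !sumrB.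
Qed.

(** In the intended case [p i j] is T(l(T e_i) e_j). *)
Let p i j := iA (L (basis i) (basis j)).
Let c i := iC (cobasis i).

Let tens_iA_linearr (x : B) : linear (fun v => tens x (iA v)).
Proof. by move=> d u v; rewrite iA_linear tens_linearr. Qed.

Let tens_iA_linearl (y : B) : linear (fun v => tens (iA v) y).
Proof. by move=> d u v; rewrite iA_linear tens_linearl. Qed.

Let tens_iC_linearr (x : B) : linear (fun f => tens x (iC f)).
Proof. by move=> d f g; rewrite iC_linear tens_linearr. Qed.

Let tens_iC_linearl (y : B) : linear (fun f => tens (iC f) y).
Proof. by move=> d f g; rewrite iC_linear tens_linearl. Qed.

Ltac multilin := split=> [? ? ? ?|? ? ? ?] /=;
  by rewrite ?(mul_bilinear.1 _ _ _ _, mul_bilinear.2 _ _ _ _)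
    ?(tens_linearl, tens_linearr).

(** In the four blocks, two images of [iA] multiply to [p i j] plus [p j i], mixed products give
    transposes that move onto the basis vector, and two images of [iC] give 0. The next two lemmas
    differ in which block plays which role. *)
Lemma skew_r13_r12 :
  prod_r13_r12 mul (t - tensor_swap t) =
    \sum_i \sum_j tens (p i j) (tens (c j) (c i))
    + \sum_i \sum_j tens (p i j) (tens (c i) (c j))
    - \sum_i \sum_j tens (c j) (tens (p i j) (c i))
    - \sum_i \sum_j tens (c j) (tens (c i) (p i j)).
Proof.
rewrite /prod_r13_r12 tensor_lift2_skew; [|by move=> ? ?; multilin..].
rewrite -[X in _ = _ - X]subr0; congr (_ - _ - (_ - _)).
- rewrite [X in _ = _ + X]exchange_big -big_split; apply: eq_bigr => i _.
  rewrite -big_split; apply: eq_bigr => j _ /=.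
  by rewrite mulAA (linear_funD _ _ (tens_linearl _)).
- apply: eq_bigr => i _; under eq_bigr do rewrite mulAC.
  exact: (sum_tens_transpose_flip _ (tens_iA_linearl (c i)) iC_linear).
- rewrite exchange_big; apply: eq_bigr => j _; under eq_bigr do rewrite mulCA.
  exact: (sum_tens_transpose_flip _ (tens_iA_linearr (c j)) iC_linear).
- rewrite big1 // => i _; rewrite big1 // => j _.
  by rewrite mulCC (linear_fun0 (tens_linearl _)).
Qed.

Lemma skew_r13_r23 :
  prod_r13_r23 mul (t - tensor_swap t) =
    - \sum_i \sum_j tens (p i j) (tens (c i) (c j))
    - (\sum_i \sum_j tens (c i) (tens (p i j) (c j))
    - (\sum_i \sum_j tens (c i) (tens (c j) (p i j))
       + \sum_i \sum_j tens (c j) (tens (c i) (p i j)))).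
Proof.
rewrite /prod_r13_r23 tensor_lift2_skew; [|by move=> ? ?; multilin..].
rewrite -[X in _ = X - _]sub0r; congr (_ - _ - (_ - _)).
- rewrite big1 // => i _; rewrite big1 // => j _.
  by rewrite mulCC !(linear_fun0 (tens_linearr _)).
- rewrite exchange_big; apply: eq_bigr => j _; under eq_bigr do rewrite mulCA.
  exact: (sum_tens_transpose _ iA_linear (tens_iC_linearr (c j))).
- apply: eq_bigr => i _; under eq_bigr do rewrite mulAC.
  exact: (sum_tens_tens_transpose (c i) _ iA_linear iC_linear).
- rewrite [X in _ = _ + X]exchange_big -big_split; apply: eq_bigr => i _.
  rewrite -big_split; apply: eq_bigr => j _ /=.
  by rewrite mulAA !(linear_funD _ _ (tens_linearr _)).
Qed.

Lemma skew_r12_r23 :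
  prod_r12_r23 mul (t - tensor_swap t) =
    \sum_i \sum_j tens (p i j) (tens (c j) (c i))
    - (\sum_i \sum_j tens (c i) (tens (p i j) (c j))
       + \sum_i \sum_j tens (c j) (tens (p i j) (c i))
       - \sum_i \sum_j tens (c i) (tens (c j) (p i j))).
Proof.
rewrite /prod_r12_r23 tensor_lift2_skew; [|by move=> ? ?; multilin..].
rewrite -[X in _ = X - _]subr0; congr (_ - _ - (_ - _)).
- rewrite exchange_big; apply: eq_bigr => j _; under eq_bigr do rewrite mulCA.
  exact: (sum_tens_transpose _ iA_linear (tens_iC_linearl (c j))).
- rewrite big1 // => i _; rewrite big1 // => j _.
  by rewrite mulCC (linear_fun0 (tens_linearl _))
    (linear_fun0 (tens_linearr _)).
- rewrite [X in _ = _ + X]exchange_big -big_split; apply: eq_bigr => i _.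
  rewrite -big_split; apply: eq_bigr => j _ /=.
  rewrite mulAA (linear_funD _ _ (tens_linearl _)).
  by rewrite (linear_funD _ _ (tens_linearr _)).
- apply: eq_bigr => i _; under eq_bigr do rewrite mulAC.
  exact: (sum_tens_tens_transpose_flip (c i) _ iA_linear iC_linear).
Qed.

Lemma adm_AYBE_skew : adm_AYBE mul D Q (t - tensor_swap t).
Proof.
have lin_id : linear (id : B -> B) by [].
have lin_D : linear D by exact: linearP.
have lin_Q : linear Q by exact: linearP.
have sumAC := sum_tens_transpose _ iA_linear iC_linear.
have sumCA := sum_tens_transpose_flip _ iA_linear iC_linear.
split.
- rewrite skew_r13_r12 skew_r13_r23 skew_r12_r23.
  (* Six sums occur: [p i j] in one of three positions, with either order of the cobasis vectors.
     Made opaque, they cancel formally. *)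
  do 6![move: (\sum_i _) => ?]; vect_ring.
(* On [t], [D] acts by [alpha] on the first leg and [Q] by its transpose on the second; on the swap
   [beta] takes the place of [alpha], with the transpose on the first leg. *)
- apply/eqP; rewrite subr_eq0; apply/eqP.
  rewrite /tensor_map !tensor_lift_skew; try exact: tensor_map_bilinear.
  congr (_ - _).
    under eq_bigr do rewrite DA; under [RHS]eq_bigr do rewrite QC.
    by rewrite sumAC.
  under eq_bigr do rewrite DC; under [RHS]eq_bigr do rewrite QA.
  by rewrite sumCA.
- apply/eqP; rewrite subr_eq0; apply/eqP.
  rewrite /tensor_map !tensor_lift_skew; try exact: tensor_map_bilinear.
  congr (_ - _).
    under eq_bigr do rewrite DC; under [RHS]eq_bigr do rewrite QA.
    by rewrite sumAC.
  under eq_bigr do rewrite DA; under [RHS]eq_bigr do rewrite QC.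
  by rewrite sumCA.
Qed.

End SkewSolution.

(** * The tensor of an O-operator and the comparison of the two dual actions *)

Section OperatorSolution.

Variables (A V : vectType k) (mul : A -> A -> A) (D Q : 'End(A)).
Variables (l : 'Hom(A, 'End(V))) (alpha beta : 'End(V)) (T : 'Hom(V, A)).
Hypotheses (hA : adm_comm_diff_algebra mul D Q)
  (hV : adm_rep mul D Q l alpha beta)
  (hT : adm_O_operator mul D Q l alpha beta T).

Lemma inl_linear : linear (fun a : A => (a, 0) : A * dual V).
Proof.
by move=> c x y; apply: injective_projections; rewrite //= scaler0 addr0.
Qed.

Lemma inr_linear : linear (fun f : dual V => (0, f) : A * dual V).
Proof.
by move=> c x y; apply: injective_projections; rewrite //= scaler0 addr0.
Qed.

Lemma operator_tensorE :
  operator_tensor T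
    = \sum_i tens ((T (basis i), 0) : A * dual V) ((0, cobasis i) : A * dual V).
Proof.
rewrite /operator_tensor /tensor_map /hom_tensor tensor_lift_sum //.
exact: (tensor_map_bilinear inl_linear inr_linear).
Qed.

Lemma adm_AYBE_operator :
  adm_AYBE (semidirect mul (- dual_rep l) (- dual_rep l))
    (direct_sum D (transpose beta)) (direct_sum Q (transpose alpha))
    (operator_tensor T - tensor_swap (operator_tensor T)).
Proof.
have hS := adm_semidirect hA (adm_rep_dual hA hV).
rewrite operator_tensorE.
(* With [L u] equal to l(T u), the product of two images of [iA] is governed by the O-operator
   identity and the mixed ones by the dual action. *)
apply: (@adm_AYBE_skew _ V _ _ _ (fun u => l (T u)) alpha beta
  (fun v => (T v, 0)) (fun f => (0, f))).
- by move=> c u v; rewrite linearP inl_linear.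
- exact: inr_linear.
- exact: adm_bilinear hS.
- move=> u v; apply: injective_projections => /=.
    by rewrite (adm_O_mul hT) linearD.
  by rewrite !linear0.
- move=> u f; apply: injective_projections => /=.
    exact: linear_fun0 (adm_linearr hA _).
  by rewrite opp_dual_repE linear0 addr0.
- move=> u f; apply: injective_projections => /=.
    exact: linear_fun0 (adm_linearl hA _).
  by rewrite (linear0 (- dual_rep l)) zero_lfunE add0r opp_dual_repE.
- move=> f g; apply: injective_projections => /=.
    exact: linear_fun0 (adm_linearl hA _).
  by rewrite (linear0 (- dual_rep l)) !zero_lfunE addr0.
- by move=> v; rewrite direct_sumE /= (adm_O_alpha hT) linear0.
- by move=> f; rewrite direct_sumE /= linear0.
- by move=> v; rewrite direct_sumE /= (adm_O_beta hT) linear0.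
- by move=> f; rewrite direct_sumE /= linear0.
Qed.

(** Move [alpha] and [beta] past l and eliminate l(Q a) by [rep_Q]: at f and v the sides differ by
    -f of (1 + 2q) l(a)(alpha + beta) v. *)
Lemma dual_induced_l q :
    (forall a v, (1 + 2 * q) *: l a ((alpha + beta) v) = 0) ->
  dual_rep (induced_l l alpha beta q) + dual_rep (induced_r l D Q q)
    = induced_l (- dual_rep l) (transpose beta) (transpose alpha) q.
Proof.
move=> defect0; apply/lfunP=> a; apply/lfunP=> f; apply/lfunP=> v.
rewrite !add_lfunE !dual_repE !induced_lE opp_dual_repE /induced_r comp_lfunE.
rewrite (transposeE (l a)) !shift_lfunE add_lfunE scale_lfunE (transposeE beta).
rewrite (transposeE alpha).
rewrite (adm_rep_betaD hV) (adm_rep_alpha hV) -(linearZ_LR f) -!(linearN f).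
rewrite -!(linearD f).
congr (f _); apply/eqP; rewrite -subr_eq0; apply/eqP.
rewrite -[RHS]oppr0 -(defect0 a v) add_lfunE !linearD !linearZ /=.
rewrite add_lfunE scale_lfunE (rep_Q hV).
vect_ring.
Qed.

Lemma dual_induced_r q :
  - dual_rep (induced_r l D Q q) = induced_r (- dual_rep l) D Q q.
Proof.
apply/lfunP=> a; apply/lfunP=> f; apply/lfunP=> v.
rewrite !opp_lfunE dual_repE opprK /induced_r !comp_lfunE.
by rewrite opp_dual_repE transposeE.
Qed.

(** The dual component at v is c times g((alpha + beta)(l a v)) + f(l((D + Q) b) v). Taking c = 1 +
    2q treats q = -1/2 and the extra condition together. *)
Lemma semidirect_dual_defect (c : k) :
    (forall a b, c *: mul a ((D + Q) b) = 0) ->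
    (forall a v, c *: l ((D + Q) a) v = 0) ->
    (forall a v, c *: (alpha + beta) (l a v) = 0) ->
  forall x y, c *: semidirect mul (- dual_rep l) (- dual_rep l) x
    ((direct_sum D (transpose beta) + direct_sum Q (transpose alpha)) y) = 0.
Proof.
move=> cmul cl cab [a f] [b g]; rewrite add_lfunE !direct_sumE.
apply: injective_projections => /=; first by rewrite -add_lfunE cmul.
rewrite !opp_dual_repE; apply/lfunP=> v.
rewrite scale_lfunE !add_lfunE (transposeE (l a)) (transposeE (l _)) add_lfunE.
rewrite (transposeE beta) (transposeE alpha) zero_lfunE -(linearD g).
rewrite scalerDr -(linearZ_LR g) -(linearZ_LR f) addrC -!add_lfunE cl.
by rewrite [beta + _]addrC cab !linear0 addr0.
Qed.

End OperatorSolution.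

End Novikov.

(** * Coincidence of the two approaches *)

Theorem proposition3p26 (k : fieldType) (char0 : [pchar k] =i pred0)
    (A V : vectType k) (mul : A -> A -> A) (D Q : 'End(A)) (q : k)
    (lA : 'Hom(A, 'End(V))) (alpha beta : 'End(V)) (T : 'Hom(V, A))
    (hA : adm_comm_diff_algebra mul D Q)
    (hV : adm_rep mul D Q lA alpha beta)
    (hT : adm_O_operator mul D Q lA alpha beta T) :
  let circ := induced_op mul D Q q in
  let lq := induced_l lA alpha beta q in
  let rq := induced_r lA D Q q in
  let lA' := - dual_rep lA in
  let lq' := induced_l lA' (transpose beta) (transpose alpha) q in
  let rq' := induced_r lA' D Q q in
  let star := forall (a : A) (v : V), lA a ((alpha + beta) v) = 0 in
  let extra :=
    [/\ forall a b : A, mul a ((D + Q) b) = 0,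
        forall (a : A) (v : V), lA ((D + Q) a) v = 0
      & forall (a : A) (v : V), (alpha + beta) (lA a v) = 0] in
  (q = - 2^-1 \/ star ->
    dual_rep lq + dual_rep rq = lq' /\ - dual_rep rq = rq') /\
  (q = - 2^-1 \/ (star /\ extra) ->
    let r := operator_tensor T - tensor_swap (operator_tensor T) in
    let op_i := semidirect circ (dual_rep lq + dual_rep rq) (- dual_rep rq) in
    let op_ii := semidirect circ lq' rq' in
    let mul_ii := semidirect mul lA' lA' in
    let D_ii := direct_sum D (transpose beta) in
    let Q_ii := direct_sum Q (transpose alpha) in
    [/\ op_i = op_ii,
        [/\ novikov_algebra circ, novikov_rep circ lq rq,
            novikov_O_operator circ lq rq T
          & antisymmetric_NYBE_solution op_i r]
      & [/\ antisymmetric_adm_AYBE_solution mul_ii D_ii Q_ii r,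
            forall x y, induced_op mul_ii D_ii Q_ii q x y = op_ii x y
          & antisymmetric_NYBE_solution op_ii r]]).
Proof.
move=> circ lq rq lA' lq' rq' star extra.
have two0 : (2 : k) != 0 by rewrite ((pcharf0P k).1 char0).
have half0 : q = - 2^-1 -> 1 + 2 * q = 0.
  by move=> ->; rewrite mulrN mulfV // subrr.
have dual_l : q = - 2^-1 \/ star -> dual_rep lq + dual_rep rq = lq'.
  move=> hq; apply: (dual_induced_l hV) => a v.
  by case: hq => [/half0 ->|->]; rewrite ?scale0r ?scaler0.
have dual_r : - dual_rep rq = rq' by exact: dual_induced_r.
split=> [hq|hq]; first by split=> //; exact: dual_l.
have hq' : q = - 2^-1 \/ star by case: hq => [|[]]; [left|right].
move=> r op_i op_ii mul_ii D_ii Q_ii.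
have e_op : op_i = op_ii by rewrite /op_i dual_l // dual_r.
have hS : adm_comm_diff_algebra mul_ii D_ii Q_ii.
  exact/adm_semidirect/adm_rep_dual.
have induced_opE : induced_op mul_ii D_ii Q_ii q =2 op_ii.
  exact: induced_semidirect.
have anti : antisymmetric_tensor r by exact: antisymmetrize_antisymmetric.
have aybe : adm_AYBE mul_ii D_ii Q_ii r by exact: adm_AYBE_operator hA hV hT.
(* Either the scalar is 0, or the extra condition kills each component. *)
have defect0 x y : (1 + 2 * q) *: mul_ii x ((D_ii + Q_ii) y) = 0.
  apply: semidirect_dual_defect => a b; case: hq => [/half0 ->|[_ [e1 e2 e3]]];
  by rewrite ?scale0r ?(e1, e2, e3) ?scaler0.
have sol : antisymmetric_NYBE_solution op_ii r.
  split=> //.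
    exact: eq_novikov_algebra induced_opE (induced_novikov hS q).
  exact: eq_NYBE induced_opE (NYBE_of_adm_AYBE hS defect0 aybe).
split; [exact: e_op| |split; [split|exact: induced_opE|exact: sol]].
- split.
  + exact: induced_novikov.
  + apply: eq_novikov_algebra (induced_novikov (adm_semidirect hA hV) q).
    exact: induced_semidirect.
  + exact: induced_O_operator.
  (* The two Novikov products are equal, so the solution obtained from the associative equation
     serves here. *)
  + by rewrite e_op.
- exact: hS.
- exact: anti.
- exact: aybe.
Qed.
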